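(* Let $\alpha>0$, let $Q_1$ be the Coordinate block privacy mechanism with blocks $\{\mathcal J_{\boldsymbol\ell}\}_{\boldsymbol\ell\in\mathcal L}$ and block privacy levels $(\alpha_{\boldsymbol\ell})_{\boldsymbol\ell\in\mathcal L}$ satisfying $\sum_{\boldsymbol\ell\in\mathcal L}\alpha_{\boldsymbol\ell}=\alpha$, and let $Q$ be the mechanism which generates, independently for each individual $1\le i\le n$, $Z_i=(Z_{i,\mathbf j})_{\mathbf j\in\mathcal J}\sim Q_1(\cdot\mid X_i)$. Then $Q$ provides non-interactive $\alpha$-LDP views of $X_1,\dots,X_n$.
   Context: $d\ge1$ is an integer, $\mathbb N^*$ the positive integers. $X_1,\dots,X_n$ take values in $[0,1]^d$. Fourier basis: $\varphi_1(t)=1$, $\varphi_{2j}(t)=\sqrt2\cos(2\pi jt)$, $\varphi_{2j+1}(t)=\sqrt2\sin(2\pi jt)$ for $j\in\mathbb N^*$, $t\in[0,1]$; $\varphi_{\mathbf j}(x)=\prod_{m=1}^d\varphi_{j_m}(x_m)$ for $\mathbf j\in(\mathbb N^* )^d$, $x\in[0,1]^d$. Non-interactive $\alpha$-LDP: a mechanism in which, given $X_i=x_i$, $Z_i\sim Q_i(\cdot\mid X_i=x_i)$ is generated independently of the other individuals, and for all $1\le i\le n$ and all $x_i,x_i'\in[0,1]^d$, $\sup_{B}\frac{Q_i(B\mid X_i=x_i)}{Q_i(B\mid X_i=x_i')}\le e^\alpha$, the supremum being over measurable sets $B$. Coordinate block privacy mechanism $Q_1$: let $\mathcal J\subset(\mathbb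 N^* )^d$ be a finite set of indices, $\{\mathcal J_{\boldsymbol\ell},\boldsymbol\ell\in\mathcal L\}$ a partition of $\mathcal J$ into blocks, $d_{\boldsymbol\ell}=|\mathcal J_{\boldsymbol\ell}|\ge1$, $\alpha_{\boldsymbol\ell}>0$ with $\sum_{\boldsymbol\ell\in\mathcal L}\alpha_{\boldsymbol\ell}=\alpha$, and $B_0=\max_{\mathbf j\in\mathcal J}\|\varphi_{\mathbf j}\|_\infty$. From $X\in[0,1]^d$ one generates $Z=(Z_{\mathbf j})_{\mathbf j\in\mathcal J}$ by performing the following independently for every block $\boldsymbol\ell\in\mathcal L$, writing $v_{[\boldsymbol\ell]}=(v_{\mathbf j})_{\mathbf j\in\mathcal J_{\boldsymbol\ell}}$. (a) Draw $\tilde V_{[\boldsymbol\ell]}\in\{-B_0,B_0\}^{d_{\boldsymbol\ell}}$ with independent coordinates, $\tilde V_{\mathbf j}=B_0$ with probability $\frac12+\frac{\varphi_{\mathbf j}(X)}{2B_0}$ and $-B_0$ otherwise. (b) Put $B_{d_{\boldsymbol\ell}}(\alpha_{\boldsymbol\ell})=B_0\frac{e^{\alpha_{\boldsymbol\ell}}+1}{e^{\alpha_{\boldsymbol\ell}}-1}\Gamma_{d_{\boldsymbol\ell}}$, where $\frac1{\Gamma_k}=\frac1{2^{k-1}}\binom{k-1}{\lfloor(k-1)/2\rfloor}$. (c) Conditionally on $\tilde V_{[\boldsymbol\ell]}=\tilde v$, and independently of $X$, draw a Bernoulli variable $Y_{\boldsymbol\ell}$ of parameter $p_{\boldsymbol\ell}=1$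 if $d_{\boldsymbol\ell}$ is odd and $p_{\boldsymbol\ell}=1-2^{-d_{\boldsymbol\ell}}\binom{d_{\boldsymbol\ell}}{d_{\boldsymbol\ell}/2}$ if $d_{\boldsymbol\ell}$ is even. If $Y_{\boldsymbol\ell}=1$, draw a Bernoulli variable $T_{\boldsymbol\ell}$ of parameter $\frac{e^{\alpha_{\boldsymbol\ell}}}{1+e^{\alpha_{\boldsymbol\ell}}}$ and draw $Z_{[\boldsymbol\ell]}$ uniformly in the set of $z\in\{\pm B_{d_{\boldsymbol\ell}}(\alpha_{\boldsymbol\ell})\}^{d_{\boldsymbol\ell}}$ with $\langle z,\tilde v\rangle>0$ if $T_{\boldsymbol\ell}=1$, with $\langle z,\tilde v\rangle<0$ if $T_{\boldsymbol\ell}=0$. If $Y_{\boldsymbol\ell}=0$, draw $Z_{[\boldsymbol\ell]}$ uniformly in the set of such $z$ with $\langle z,\tilde v\rangle=0$. *)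

(* Defs.v *)
From HB Require Import structures.
From mathcomp Require Import all_boot all_order all_algebra finmap.
From mathcomp Require Import all_classical all_reals all_analysis.
From mathcomp Require Import measurable_realfun.
From mathcomp Require Import ring lra zify.
Import Order.TTheory GRing.Theory Num.Theory.
Import numFieldNormedType.Exports.
Set Implicit Arguments.
Unset Strict Implicit.
Unset Printing Implicit Defensive.
Local Open Scope classical_set_scope.
Local Open Scope ring_scope.

Section privacy.
Context {R : realType} {dX dZ : measure_display}.
Context {X : measurableType dX} {Z : measurableType dZ}.

(* In \bar R one has 0^-1 = +oo and 0 * +oo = 0, hence 0 / 0 = 0 while
   c / 0 = +oo for c > 0. *)
Definition alpha_private (alpha : R) (K : R.-pker X ~> Z) : Prop :=
  forall x x' : X,
    (ereal_sup [set K x B / K x' B | B in measurable] <= (expR alpha)%:E)%E.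

(* Conditionally on the data x, the outputs are independent and the i-th one
   has law K i (x_i). *)
Definition generated_independently n (Q : R.-pker (n.-tuple X) ~> (n.-tuple Z))
    (K : 'I_n -> R.-pker X ~> Z) : Prop :=
  forall (x : n.-tuple X) (A : 'I_n -> set Z), (forall i, measurable (A i)) ->
    Q x [set z | forall i, A i (tnth z i)] =
    (\prod_(i < n) K i (tnth x i) (A i))%E.

Definition noninteractive_LDP n (alpha : R)
    (Q : R.-pker (n.-tuple X) ~> (n.-tuple Z)) : Prop :=
  exists K : 'I_n -> R.-pker X ~> Z,
    generated_independently Q K /\ forall i, alpha_private alpha (K i).

End privacy.

Section finite_mixture.
Local Open Scope ereal_scope.
Context {R : realType} {dX dZ : measure_display}.
Context {X : measurableType dX} {Z : measurableType dZ} {A : finType}.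
Variables (w : X -> A -> R) (z : A -> Z).
Hypothesis w_ge0 : forall x a, (0 <= w x a)%R.
Hypothesis w_sum1 : forall x, (\sum_a w x a = 1)%R.
Hypothesis w_meas : forall a, measurable_fun setT (w ^~ a).

Definition mixture of (forall x a, (0 <= w x a)%R) &
    (forall x, (\sum_a w x a = 1)%R) &
    (forall a, measurable_fun setT (w ^~ a)) :=
  fun (x : X) (U : set Z) => \sum_a (w x a)%:E * \d_(z a) U.

Local Notation mix := (mixture w_ge0 w_sum1 w_meas).

Let mix0 x : mix x set0 = 0.
Proof. by rewrite /mixture big1// => a _; rewrite measure0 mule0. Qed.

Let mix_ge0 x U : 0 <= mix x U.
Proof. by apply: sume_ge0 => a _; rewrite mule_ge0// lee_fin. Qed.

Let mix_sigma_additive x : semi_sigma_additive (mix x).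
Proof.
move=> F mF tF mUF; rewrite [X in _ --> X](_ : _ =
    lim ((fun n => \sum_(0 <= i < n) mix x (F i)) @ \oo)).
  by apply: is_cvg_ereal_nneg_natsum => k _; exact: mix_ge0.
rewrite nneseries_sum//; last by move=> a j _; rewrite mule_ge0// lee_fin.
apply: eq_bigr => /= a _.
rewrite nneseriesZl//; congr (_ * _); first exact: measure_semi_bigcup.
Qed.

HB.instance Definition _ x := isMeasure.Build _ _ _ (mix x)
  (mix0 x) (mix_ge0 x) (@mix_sigma_additive x).

Definition mixture_measure : X -> {measure set Z -> \bar R} := fun x => mix x.

Let mix_kernel U : measurable U -> measurable_fun setT (mixture_measure ^~ U).
Proof.
move=> mU; apply: emeasurable_sum => a.
apply: emeasurable_funM; last exact: measurable_cst.
by apply/measurable_EFinP; exact: w_meas.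
Qed.

HB.instance Definition _ :=
  isKernel.Build _ _ _ _ R mixture_measure mix_kernel.

Let mix_setT x : mixture_measure x setT = 1.
Proof.
rewrite /mixture_measure/= /mixture.
under eq_bigr do rewrite diracT mule1.
by rewrite sumEFin w_sum1.
Qed.

HB.instance Definition _ :=
  Kernel_isProbability.Build _ _ _ _ R mixture_measure mix_setT.

Definition mixture_kernel : R.-pker X ~> Z := mixture_measure.

End finite_mixture.

Section independent_mixtures.
Context {R : realType} {dX dZ : measure_display}.
Context {X : measurableType dX} {Z : measurableType dZ} {A : finType} {n : nat}.
Variables (w : X -> A -> R) (z : A -> Z).
Hypothesis w_ge0 : forall x a, 0 <= w x a.
Hypothesis w_sum1 : forall x, \sum_a w x a = 1.
Hypothesis w_meas : forall a, measurable_fun setT (w ^~ a).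

Lemma independent_mixtures_exist :
  exists Q : R.-pker (n.-tuple X) ~> (n.-tuple Z),
    generated_independently Q (fun _ => mixture_kernel z w_ge0 w_sum1 w_meas).
Proof.
pose W (x : n.-tuple X) (s : {ffun 'I_n -> A}) := \prod_i w (tnth x i) (s i).
have W0 x s : 0 <= W x s by apply: prodr_ge0.
have W1 x : \sum_s W x s = 1.
  rewrite -(bigA_distr_bigA (fun i a => w (tnth x i) a)).
  by rewrite big1.
have Wm s : measurable_fun setT (W ^~ s).
  apply: measurable_prod => i _.
  apply: (measurableT_comp (w_meas (s i))); exact: measurable_tnth.
exists (mixture_kernel (fun s : {ffun 'I_n -> A} => [tuple z (s i) | i < n]) W0 W1 Wm).
move=> x B mB; rewrite /mixture_kernel/= /mixture_measure/= /mixture.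
transitivity (\sum_(s : {ffun 'I_n -> A}) (\prod_i (w (tnth x i) (s i) *
    (z (s i) \in B i)%:R)))%:E%E; last first.
  rewrite -(bigA_distr_bigA (fun i a => w (tnth x i) a * (z a \in B i)%:R)).
  rewrite -prodEFin; apply: eq_bigr => i _.
  by rewrite -sumEFin; apply: eq_bigr => a _; rewrite diracE EFinM.
rewrite -sumEFin; apply: eq_bigr => /= s _.
rewrite diracE -EFinM big_split/=; congr (_ * _)%:E.
have [/set_mem h|h] := boolP (_ \in _).
  rewrite big1// => i _; rewrite mem_set//.
  by have := h i; rewrite tnth_mktuple.
suff [i hi] : exists i, z (s i) \notin B i.
  by rewrite (bigD1 i)//= (negbTE hi) mul0r.
apply: contrapT => H; move/negP: h; apply; apply/mem_set => i /=.
rewrite tnth_mktuple; apply/set_mem/negPn/negP => hi; apply: H.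
by exists i.
Qed.

End independent_mixtures.

Definition in_cube (R : realType) d (x : d.-tuple R) : bool :=
  [forall m, 0 <= tnth x m <= 1].

Section cube.
Variables (R : realType) (d : nat).

Definition cube_point := {x : d.-tuple R | in_cube x}.

Lemma in_cube0 : in_cube [tuple (0 : R) | _ < d].
Proof. by apply/forallP => m; rewrite tnth_mktuple lexx ler01. Qed.

HB.instance Definition _ := Choice.on cube_point.
HB.instance Definition _ :=
  isPointed.Build cube_point (exist (fun x => in_cube x) _ in_cube0).

(* The sigma-algebra is the trace on [0,1]^d of the Borel sets of R^d. *)
Definition cube :=
  g_sigma_algebra_preimageType (sval : cube_point -> d.-tuple R).

HB.instance Definition _ := Measurable.on cube.

Definition coord (x : cube) (m : 'I_d) : R := tnth (sval x) m.

Lemma coord_itv x m : 0 <= coord x m <= 1.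
Proof. exact: (forallP (svalP x) m). Qed.

Lemma measurable_coord m : measurable_fun setT (coord ^~ m).
Proof.
move=> _ U mU; rewrite setTI; exists ((@tnth _ _ ^~ m) @^-1` U) => //.
  by rewrite -[X in measurable X]setTI; apply: measurable_tnth.
by rewrite setTI.
Qed.

End cube.

Section euclidean.
Variables (R : realType) (J : finType).

HB.instance Definition _ := isPointed.Build {ffun J -> R} [ffun => 0].

(* R^J with the product sigma-algebra, transported from #|J|.-tuple R. *)
Definition rspace := g_sigma_algebra_preimageType (@fgraph J R).

HB.instance Definition _ := Measurable.on rspace.

End euclidean.

Definition posnat := {k : nat | (0 < k)%N}.

Section fourier.
Variables (R : realType) (d : nat).

(* For k = 2j and k = 2j + 1 the frequency k./2 is j. *)
Definition fourier1 (k : nat) (t : R) : R :=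
  if k == 1%N then 1
  else if odd k then Num.sqrt 2 * sin (2 * pi * k./2%:R * t)
  else Num.sqrt 2 * cos (2 * pi * k./2%:R * t).

Definition fourier (j : d.-tuple posnat) (x : cube R d) : R :=
  \prod_(m < d) fourier1 (val (tnth j m)) (coord x m).

Definition sup_norm (f : cube R d -> R) : R := sup [set `|f x| | x in setT].

Lemma fourier1_bound k t : `|fourier1 k t| <= Num.sqrt 2.
Proof.
have s1 : 1 <= Num.sqrt 2 :> R by rewrite -[leLHS]sqrtr1 ler_sqrt ?ler1n// ltr0n.
rewrite /fourier1; case: ifP => _; first by rewrite normr1.
case: ifP => _; rewrite normrM ger0_norm ?sqrtr_ge0// ler_piMr ?sqrtr_ge0//.
- by rewrite ler_norml sin_geN1 sin_le1.
- by rewrite ler_norml cos_geN1 cos_le1.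
Qed.

Lemma fourier_bound j x : `|fourier j x| <= Num.sqrt 2 ^+ d.
Proof.
rewrite /fourier normr_prod -[X in _ ^+ X]card_ord -prodr_const.
by apply: ler_prod => m _; rewrite normr_ge0 fourier1_bound.
Qed.

Lemma le_sup_norm_fourier j x : `|fourier j x| <= sup_norm (fourier j).
Proof.
apply: ub_le_sup; last by exists x.
by exists (Num.sqrt 2 ^+ d) => _ [y _ <-]; exact: fourier_bound.
Qed.

Lemma fourier1_neq0 k : (0 < k)%N ->
  exists t : R, 0 <= t <= 1 /\ fourier1 k t != 0.
Proof.
move=> k0; rewrite /fourier1; have [_|k1] := eqVneq k 1%N.
  by exists 0; rewrite lexx ler01 oner_neq0.
have s2 : Num.sqrt 2 != 0 :> R by rewrite sqrtr_eq0 -ltNge ltr0n.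
case ok: (odd k); last first.
  by exists 0; rewrite lexx ler01 mulr0 cos0 mulr1.
have h0 : (0 < k./2)%N by case: k k0 k1 ok => [|[|[]]].
have h1 : 1 <= k./2%:R :> R by rewrite ler1n.
exists (4 * k./2%:R)^-1; split.
  rewrite invr_ge0 mulr_ge0//= invf_le1; lra.
rewrite (_ : _ * (4 * _)^-1 = pi / 2); first by rewrite sin_pihalf mulr1.
by field; rewrite lt0r_neq0//; lra.
Qed.

Lemma sup_norm_fourier_gt0 j : 0 < sup_norm (fourier j).
Proof.
have /choice[t ht] : forall m, exists t : R, 0 <= t <= 1 /\
    fourier1 (val (tnth j m)) t != 0.
  by move=> m; apply: fourier1_neq0; exact: valP.
have cx : in_cube [tuple t m | m < d].
  by apply/forallP => m; rewrite tnth_mktuple (ht m).1.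
pose x : cube R d := exist (fun x => in_cube x) _ cx.
apply: lt_le_trans (le_sup_norm_fourier j x).
rewrite normr_gt0; apply/prodf_neq0 => m _.
by rewrite /coord /= tnth_mktuple (ht m).2.
Qed.

Lemma measurable_fourier j : measurable_fun setT (fourier j).
Proof.
apply: measurable_prod => m _.
apply: (@measurableT_comp _ _ _ _ _ _ (fourier1 (val (tnth j m)))); last first.
  exact: measurable_coord.
rewrite /fourier1; case: (_ == _) => /=; first exact: measurable_cst.
have lin : continuous (fun t : R => 2 * pi * (val (tnth j m))./2%:R * t).
  by move=> t; apply: mulrl_continuous.
case: (odd _); apply: measurable_funM => //;
  apply: continuous_measurable_fun => t.
- by apply: continuous_comp; [exact: lin|exact: continuous_sin].
- by apply: continuous_comp; [exact: lin|exact: continuous_cos].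
Qed.

End fourier.

Section block.
Variables (R : realType) (T : finType).

(* B0 : the range of the coordinates; b : the set of coordinates of the block;
   a : the privacy level of the block. *)
Variables (B0 : R) (b : {set T}) (a : R).

Definition Gamma (k : nat) : R := ('C(k.-1, k.-1./2)%:R / 2 ^+ k.-1)^-1.

Definition out_range : R :=
  B0 * ((expR a + 1) / (expR a - 1)) * Gamma #|b|.

(* A vector of {-c, c}^b is encoded by the subset of b where it equals c. *)
Definition pm_val (c : R) (v : {set T}) (j : T) : R :=
  if j \in v then c else - c.

Definition inner (z v : {set T}) : R :=
  \sum_(j in b) pm_val out_range z j * pm_val B0 v j.

(* It vanishes when A is empty: this is the tie case of release_pmf for odd
   #|b|, which has weight 1 - nontie_param = 0. *)
Definition unif_pmf (A : {set {set T}}) (z : {set T}) : R :=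
  (z \in A)%:R / #|A|%:R.

Definition nontie_param : R :=
  if odd #|b| then 1 else 1 - 'C(#|b|, #|b|./2)%:R / 2 ^+ #|b|.

Definition tilde_pmf (phi : T -> R) (v : {set T}) : R :=
  \prod_(j in b) bernoulli_pmf (2^-1 + phi j / (2 * B0)) (j \in v).

(* The law of the output given the randomized vector v. *)
Definition release_pmf (v z : {set T}) : R :=
  \sum_(y : bool) bernoulli_pmf nontie_param y *
    if y then
      \sum_(t : bool) bernoulli_pmf (expR a / (1 + expR a)) t *
        unif_pmf (if t then [set s in powerset b | 0 < inner s v]%SET
                  else [set s in powerset b | inner s v < 0]%SET) z
    else unif_pmf [set s in powerset b | inner s v == 0]%SET z.

Definition block_pmf (phi : T -> R) (z : {set T}) : R :=
  \sum_(v in powerset b) tilde_pmf phi v * release_pmf v z.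

Hypothesis B0_gt0 : 0 < B0.
Hypothesis a_gt0 : 0 < a.
Hypothesis b_neq0 : b != finset.set0.

Lemma unif_pmf_ge0 (A : {set {set T}}) z : 0 <= unif_pmf A z.
Proof. by rewrite /unif_pmf divr_ge0 ?ler0n. Qed.

Lemma sum_unif_pmf (A : {set {set T}}) : A \subset powerset b -> A != finset.set0 ->
  \sum_(z in powerset b) unif_pmf A z = 1.
Proof.
move=> sA A0; rewrite -mulr_suml -natr_sum.
rewrite (_ : (\sum_(i in powerset b) _)%N = #|A|).
  by rewrite divff// pnatr_eq0 cards_eq0.
rewrite -sum1_card [RHS]big_mkcond/= (big_setID A)/= [X in (_ + X)%N]big1.
  rewrite addn0 (finset.setIidPr sA) [LHS]big_mkcond.
  by apply: eq_bigr => i _; case: (i \in A).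
by move=> i; rewrite inE => /andP[/negbTE->].
Qed.

Lemma Gamma_gt0 k : 0 < Gamma k.
Proof.
rewrite /Gamma invr_gt0 divr_gt0 ?exprn_gt0 ?ltr0n// bin_gt0.
by rewrite -[leqRHS]odd_double_half -addnn; lia.
Qed.

Lemma out_range_gt0 : 0 < out_range.
Proof.
have e1 : 1 < expR a by rewrite pexpR_gt1.
by rewrite /out_range !mulr_gt0 ?Gamma_gt0// ?invr_gt0; lra.
Qed.

Lemma nontie_param_itv : 0 <= nontie_param <= 1.
Proof.
rewrite /nontie_param; case: ifP => _; first by rewrite ler01 lexx.
have p : 0 < 2 ^+ #|b| :> R by rewrite exprn_gt0.
have h : 'C(#|b|, #|b|./2)%:R / 2 ^+ #|b| <= 1 :> R.
  rewrite ler_pdivrMr// mul1r -natrX ler_nat -[X in (_ <= X ^ _)%N]/(1 + 1)%N expnDn.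
  have h : (#|b|./2 < #|b|.+1)%N by lia.
  by rewrite (bigD1 (Ordinal h))//= !exp1n !muln1 leq_addr.
have := divr_ge0 (ler0n R 'C(#|b|, #|b|./2)) (ltW p).
by move=> h'; apply/andP; split; lra.
Qed.

Lemma inner_self (v : {set T}) : 0 < inner v v.
Proof.
have h : 0 < out_range * B0 by rewrite mulr_gt0// out_range_gt0.
rewrite /inner (eq_bigr (fun=> out_range * B0)); last first.
  by move=> j _; rewrite /pm_val; case: ifP; rewrite ?mulrNN.
by rewrite sumr_const pmulrn_lgt0// card_gt0.
Qed.

Lemma inner_opp (v : {set T}) : inner (b :\: v) v < 0.
Proof.
have h : 0 < out_range * B0 by rewrite mulr_gt0// out_range_gt0.
rewrite /inner (eq_bigr (fun=> - (out_range * B0))); last first.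
  by move=> j jb; rewrite /pm_val inE jb andbT; case: (j \in v);
    rewrite /= ?mulNr ?mulrN.
by rewrite sumrN oppr_lt0 sumr_const pmulrn_lgt0// card_gt0.
Qed.

Lemma inner_tie (v : {set T}) : ~~ odd #|b| ->
  exists2 z, z \in powerset b & inner z v == 0.
Proof.
move=> ek.
have [u ub cu] : exists2 u : {set T}, u \subset b & #|u| = #|b|./2.
  have : (0 < #|[set u : {set T} | u \subset b & #|u| == #|b|./2]%SET|)%N.
    by rewrite cards_draws bin_gt0; lia.
  by case/card_gt0P => u; rewrite inE => /andP[ub /eqP cu]; exists u.
exists [set j in b | (j \in u) == (j \in v)]%SET.
  by rewrite powersetE; apply/fintype.subsetP => j; rewrite inE => /andP[].
rewrite /inner (big_setID u)/= (finset.setIidPr ub).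
rewrite (eq_bigr (fun=> out_range * B0)); last first.
  move=> j ju; rewrite /pm_val inE (fintype.subsetP ub _ ju) ju/=.
  by case: (j \in v); rewrite /= ?mulrNN.
rewrite [X in _ + X](eq_bigr (fun=> - (out_range * B0))); last first.
  move=> j; rewrite inE => /andP[/negbTE ju jb]; rewrite /pm_val inE jb ju/=.
  by case: (j \in v); rewrite /= ?mulNr ?mulrN.
rewrite sumrN !sumr_const cardsD (finset.setIidPr ub) cu.
by rewrite (_ : #|b| - _ = #|b|./2)%N ?subrr//; lia.
Qed.

Lemma level_param_itv : 0 <= expR a / (1 + expR a) <= 1.
Proof.
have h := expR_gt0 a; apply/andP; split.
  by rewrite divr_ge0//; lra.
by rewrite ler_pdivrMr; lra.
Qed.

Lemma release_pmf_ge0 v z : 0 <= release_pmf v z.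
Proof.
apply: sumr_ge0 => y _; apply: mulr_ge0.
  exact/bernoulli_pmf_ge0/nontie_param_itv.
case: y; last exact: unif_pmf_ge0.
apply: sumr_ge0 => t _; apply: mulr_ge0; last exact: unif_pmf_ge0.
exact/bernoulli_pmf_ge0/level_param_itv.
Qed.

Lemma sum_release_pmf v : v \in powerset b ->
  \sum_(z in powerset b) release_pmf v z = 1.
Proof.
move=> vb; have sub P : [set s in powerset b | P s]%SET \subset powerset b.
  by apply/fintype.subsetP => s; rewrite inE => /andP[].
have pos : \sum_(z in powerset b)
    unif_pmf [set s in powerset b | 0 < inner s v]%SET z = 1.
  apply: sum_unif_pmf => //; apply/set0Pn; exists v.
  by rewrite inE vb inner_self.
have neg : \sum_(z in powerset b)
    unif_pmf [set s in powerset b | inner s v < 0]%SET z = 1.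
  apply: sum_unif_pmf => //; apply/set0Pn; exists (b :\: v).
  by rewrite inE inner_opp powersetE subsetDl.
have tie : ~~ odd #|b| -> \sum_(z in powerset b)
    unif_pmf [set s in powerset b | inner s v == 0]%SET z = 1.
  move=> /(inner_tie v)[z zb z0].
  by apply: sum_unif_pmf => //; apply/set0Pn; exists z; rewrite inE zb.
rewrite exchange_big/= big_bool/= -!mulr_sumr.
rewrite [X in _ * X + _]exchange_big/= big_bool/= -!mulr_sumr pos neg.
rewrite !mulr1 (addrC (expR a / _)) subrK mulr1 addrC.
have [ob|eb] := boolP (odd #|b|).
  by rewrite /nontie_param ob subrr mul0r add0r.
by rewrite tie// mulr1 subrK.
Qed.

Lemma tilde_pmf_ge0 phi v : (forall j, `|phi j| <= B0) -> 0 <= tilde_pmf phi v.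
Proof.
move=> hphi; apply: prodr_ge0 => j _; apply: bernoulli_pmf_ge0.
have := hphi j; rewrite ler_norml => /andP[h1 h2].
rewrite (_ : _ + _ = (B0 + phi j) / (2 * B0)); last by field; rewrite lt0r_neq0.
have h0 : 0 < 2 * B0 by rewrite mulr_gt0.
by apply/andP; split; [apply: divr_ge0|rewrite ler_pdivrMr]; lra.
Qed.

Lemma sum_tilde_pmf phi : \sum_(v in powerset b) tilde_pmf phi v = 1.
Proof.
pose q j := 2^-1 + phi j / (2 * B0).
pose F j := if j \in b then q j else 0.
pose G j := if j \in b then 1 - q j else 1.
transitivity (\prod_j (F j + G j)); last first.
  apply: big1 => j _; rewrite /F /G; case: ifP => _; last by rewrite add0r.
  by rewrite addrC subrK.
rewrite bigA_distr big_mkcond/=; apply: eq_big => // v _.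
case: ifPn; rewrite powersetE.
  move=> /fintype.subsetP vb; rewrite /tilde_pmf big_mkcond/=; apply: eq_bigr => j _.
  rewrite /F /G /bernoulli_pmf; case: ifPn => jb; last first.
    by rewrite (contraNF (vb j) jb).
  by case: ifP.
by move=> /fintype.subsetPn[j jv jb]; rewrite (bigD1 j)//= jv /F (negbTE jb) mul0r.
Qed.

Lemma block_pmf_ge0 phi z : (forall j, `|phi j| <= B0) -> 0 <= block_pmf phi z.
Proof.
move=> h; apply: sumr_ge0 => v _.
by rewrite mulr_ge0 ?tilde_pmf_ge0 ?release_pmf_ge0.
Qed.

Lemma sum_block_pmf phi : \sum_(z in powerset b) block_pmf phi z = 1.
Proof.
rewrite exchange_big/= -[RHS](sum_tilde_pmf phi); apply: eq_bigr => v vb.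
by rewrite -mulr_sumr sum_release_pmf// mulr1.
Qed.

End block.

Section measurable_big.
Context {R : realType} {dX : measure_display} {X : measurableType dX}.
Context {I : finType}.

Lemma measurable_prod_cond (P : pred I) (h : I -> X -> R) :
  (forall i, measurable_fun setT (h i)) ->
  measurable_fun setT (fun x => \prod_(i | P i) h i x).
Proof.
move=> mh; rewrite (_ : (fun x => _) =
    (fun x => \prod_i if P i then h i x else 1)).
  by apply: measurable_prod => i _; case: (P i).
by apply/funext => x; rewrite big_mkcond.
Qed.

Lemma measurable_sum_cond (P : pred I) (h : I -> X -> R) :
  (forall i, measurable_fun setT (h i)) ->
  measurable_fun setT (fun x => \sum_(i | P i) h i x).
Proof.
move=> mh; rewrite (_ : (fun x => _) =
    (fun x => \sum_i if P i then h i x else 0)).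
  by apply: measurable_sum => i; case: (P i).
by apply/funext => x; rewrite big_mkcond.
Qed.

End measurable_big.

Record block_design (R : realType) (d : nat) := BlockDesign {
  index_set : {fset d.-tuple posnat};
  blocks : {set {set index_set}};
  level : {set index_set} -> R;
  blocks_partition : finset.partition blocks [set: index_set]%SET;
  level_gt0 : forall b, b \in blocks -> 0 < level b
}.

Arguments blocks {R d} _.
Arguments level {R d} _.
Arguments blocks_partition {R d} _.
Arguments level_gt0 {R d} _.

Section mechanism.
Variables (R : realType) (d : nat) (D : block_design R d).

Let J : finType := index_set D.

Definition max_sup_norm : R :=
  \big[Num.max/0]_(j : J) sup_norm (fourier (R := R) (val j)).

Local Notation B0 := max_sup_norm.

(* An element of \prod_j {-B_j, B_j} is encoded by the set of the j where it
   equals B_j, and its restriction to the block b by the trace of that set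
   on b. *)
Definition mechanism_pmf (x : cube R d) (z : {set J}) : R :=
  \prod_(b in blocks D)
    block_pmf B0 b (level D b) (fun j => fourier (val j) x) (z :&: b)%SET.

Definition released (z : {set J}) : rspace R J :=
  [ffun j => let b := finset.pblock (blocks D) j in
             pm_val (out_range B0 b (level D b)) z j].

Lemma fourier_le_max (j : J) x : `|fourier (val j) x| <= B0.
Proof.
apply: le_trans (le_sup_norm_fourier (val j) x) _.
exact: (le_bigmax _ (fun j : J => sup_norm (fourier (R := R) (val j)))).
Qed.

Lemma block_neq0 b : b \in blocks D -> b != finset.set0.
Proof.
have /and3P[_ _ h] := blocks_partition D.
by apply: contraTneq => ->.
Qed.

Lemma max_sup_norm_gt0 b : b \in blocks D -> 0 < B0.
Proof.
move=> /block_neq0/set0Pn[j _].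
apply: lt_le_trans (sup_norm_fourier_gt0 R (val j)) _.
exact: (le_bigmax _ (fun j : J => sup_norm (fourier (R := R) (val j)))).
Qed.

Lemma mechanism_pmf_ge0 x z : 0 <= mechanism_pmf x z.
Proof.
apply: prodr_ge0 => b bD; apply: block_pmf_ge0.
- exact: max_sup_norm_gt0 bD.
- exact: level_gt0.
- exact: block_neq0.
- by move=> j; exact: fourier_le_max.
Qed.

Lemma mechanism_pmf_sum1 x : \sum_z mechanism_pmf x z = 1.
Proof.
have /and3P[/eqP cov triv _] := blocks_partition D.
pose f b := block_pmf B0 b (level D b) (fun j : J => fourier (val j) x).
transitivity (\prod_(b in blocks D) \sum_(z in powerset b) f b z); last first.
  apply: big1 => b bD; apply: sum_block_pmf.
  - exact: max_sup_norm_gt0 bD.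
  - exact: level_gt0.
  - exact: block_neq0.
rewrite (big_distr_big_dep finset.set0 _
  (fun b => [pred z | z \in powerset b]))/=.
pose h (z : {set J}) : {ffun {set J} -> {set J}} :=
  [ffun b => if b \in blocks D then (z :&: b)%SET else finset.set0].
pose h' (g : {ffun {set J} -> {set J}}) : {set J} :=
  (\bigcup_(b in blocks D) g b)%SET.
rewrite (reindex_onto h h')/=.
  apply: eq_big => [z|z _]; last first.
    by apply: eq_bigr => b bD; rewrite /h ffunE bD.
  apply/esym/andP; split.
    apply/pfamilyP; split.
      apply/fintype.subsetP => b; rewrite inE /h ffunE.
      by case: ifP => //; rewrite eqxx.
    by move=> b bD; rewrite /h ffunE bD !inE subsetIr.
  apply/eqP/setP => j; apply/bigcupP/idP => [[b bD]|jz].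
    by rewrite /h ffunE bD inE => /andP[].
  have jc : j \in finset.cover (blocks D) by rewrite cov inE.
  exists (finset.pblock (blocks D) j); first exact: pblock_mem.
  by rewrite /h ffunE pblock_mem// inE jz mem_pblock.
move=> g /pfamilyP[supp gb]; apply/ffunP => b; rewrite /h ffunE.
case: ifPn => bD; last first.
  apply/esym/eqP; apply: contraNT bD => gb0.
  by apply: (fintype.subsetP supp); rewrite inE.
have sub c : c \in blocks D -> g c \subset c.
  by move=> /gb; rewrite !inE.
apply/setP => j; rewrite inE; apply/andP/idP => [[/bigcupP[c cD jc] jb]|jg].
  have jc' := fintype.subsetP (sub _ cD) _ jc.
  by rewrite -(def_pblock triv bD jb) (def_pblock triv cD jc').
split; last exact: fintype.subsetP (sub _ bD) _ jg.
by apply/bigcupP; exists b.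
Qed.

Lemma measurable_mechanism_pmf z : measurable_fun setT (mechanism_pmf ^~ z).
Proof.
apply: measurable_prod_cond => b; apply: measurable_sum_cond => v.
apply: measurable_funM => //; apply: measurable_prod_cond => j.
have mp : measurable_fun setT
    (fun x : cube R d => 2^-1 + fourier (val j) x / (2 * B0)).
  apply: measurable_funD => //; apply: measurable_funM => //.
  exact: measurable_fourier.
by rewrite /bernoulli_pmf; case: (j \in v) => //; exact: measurable_funB.
Qed.

Definition coordinate_block_mechanism : R.-pker (cube R d) ~> (rspace R J) :=
  mixture_kernel released mechanism_pmf_ge0 mechanism_pmf_sum1
    measurable_mechanism_pmf.

(* The hypothesis generated_independently can be met for this mechanism. *)
Lemma iid_coordinate_block_mechanism_exists n :
  exists Q : R.-pker (n.-tuple (cube R d)) ~> (n.-tuple (rspace R J)),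
    generated_independently Q (fun _ : 'I_n => coordinate_block_mechanism).
Proof. exact: independent_mixtures_exist. Qed.

End mechanism.

(* Main.v *)
Require Import Defs.
From mathcomp Require Import all_boot all_order all_algebra finmap.
From mathcomp Require Import all_classical all_reals all_analysis.
From mathcomp Require Import measurable_realfun.
From mathcomp Require Import ring lra zify.
Set Implicit Arguments.
Unset Strict Implicit.
Unset Printing Implicit Defensive.
Import Order.TTheory GRing.Theory Num.Theory.
Local Open Scope ring_scope.

(** The proof bounds likelihood ratios.  In one block [b] with [k] coordinates
    and level [a], fix the randomized vector [v] and sort the outputs [z] by the
    sign of [<z, v>].  Flipping every coordinate of the output exchanges the
    outputs with [<z, v> > 0], say [N] of them, and those with [<z, v> < 0],
    while the number [N0] of ties is [C(k, k/2)] for even [k] and [0] for odd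
    [k].  The parameter of [Y] is therefore exactly
    [p = 2 N / 2 ^ k], and [1 - p = N0 / 2 ^ k], so that the law of the output
    given [v] has density, with respect to the uniform law on the [2 ^ k]
    possible outputs, equal to [2 e^a / (1 + e^a)], [2 / (1 + e^a)] or [1]
    according to the sign of [<z, v>] ([release_pmfE]).  Any two of these three
    values have a ratio at most [e^a] ([release_pmf_ratio]).

    The raw data only enters a block through the law of [v], and averaging over
    [v] keeps the bound ([le_mean_ratio], [block_pmf_ratio]).  Blocks are
    independent, so the ratios multiply and the levels add up to [alpha]
    ([mechanism_pmf_ratio]).  A pointwise bound on the weights of a mixture of
    Dirac measures passes to all measurable sets ([mixture_private]), which is
    the privacy of the channel of each individual. *)

(** * Finite laws with bounded likelihood ratio *)

(** Every value of [f] is at most [c] times every value of [f], hence so are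
    the weighted means, whatever the two weightings are. *)
Lemma le_mean_ratio (R : realFieldType) (I : finType) (A : {set I}) (c : R)
    (f p q : I -> R) :
  (forall i, i \in A -> 0 <= p i) -> (forall i, i \in A -> 0 <= q i) ->
  \sum_(i in A) p i = 1 -> \sum_(i in A) q i = 1 ->
  (forall i j, i \in A -> j \in A -> f i <= c * f j) ->
  \sum_(i in A) p i * f i <= c * \sum_(j in A) q j * f j.
Proof.
move=> p0 q0 p1 q1 fc.
have lhs_le j : j \in A -> \sum_(i in A) p i * f i <= c * f j.
  move=> jA; rewrite -[leRHS]mul1r -p1 mulr_suml.
  by apply: ler_sum => i iA; rewrite ler_wpM2l ?p0 ?fc.
rewrite -[leLHS]mul1r -q1 mulr_suml mulr_sumr.
by apply: ler_sum => j jA; rewrite mulrCA ler_wpM2l ?q0 ?lhs_le.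
Qed.

Section mixture_privacy.
Context {R : realType} {dX dZ : measure_display}.
Context {X : measurableType dX} {Z : measurableType dZ} {A : finType}.
Variables (w : X -> A -> R) (z : A -> Z).
Hypothesis w_ge0 : forall x a, 0 <= w x a.
Hypothesis w_sum1 : forall x, \sum_a w x a = 1.
Hypothesis w_meas : forall a, measurable_fun setT (w ^~ a).

Local Notation K := (mixture_kernel z w_ge0 w_sum1 w_meas).

Lemma mixture_kernelE x B :
  K x B = (\sum_a w x a * (z a \in B)%:R)%:E.
Proof.
rewrite /mixture_kernel /= /mixture_measure /= /mixture -sumEFin.
by apply: eq_bigr => a _; rewrite diracE EFinM.
Qed.

(** A common bound on the weights also bounds the probability of every event;
    in particular an event that is null for [x'] is null for [x], so the ratio
    [c / 0 = +oo] with [c > 0] never occurs. *)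
Lemma mixture_private (alpha : R) :
  (forall x x' a, w x a <= expR alpha * w x' a) -> alpha_private alpha K.
Proof.
move=> w_ratio x x'; apply: ge_ereal_sup => _ [B _ <-].
rewrite !mixture_kernelE.
set s := \sum_a _; set s' := \sum_a _.
have s_ge0 : 0 <= s by apply: sumr_ge0 => a _; rewrite mulr_ge0.
have s'_ge0 : 0 <= s' by apply: sumr_ge0 => a _; rewrite mulr_ge0.
have s_le : s <= expR alpha * s'.
  by rewrite mulr_sumr; apply: ler_sum => a _; rewrite mulrA ler_wpM2r.
have [s'0|s'_neq0] := eqVneq s' 0.
  have -> : s = 0.
    by apply/eqP; rewrite eq_le s_ge0 andbT -(mulr0 (expR alpha)) -s'0.
  by rewrite mul0e lee_fin expR_ge0.
by rewrite inver (negbTE s'_neq0) -EFinM lee_fin ler_pdivrMr// lt0r s'_neq0.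
Qed.

End mixture_privacy.

(** * One block *)

Section block_privacy.
Variables (R : realType) (T : finType) (B0 : R) (b : {set T}) (a : R).
Hypothesis B0_gt0 : 0 < B0.
Hypothesis a_gt0 : 0 < a.
Hypothesis b_neq0 : b != finset.set0.

Local Notation inner := (inner B0 b a).
Local Notation posS v := [set s in powerset b | 0 < inner s v]%SET.
Local Notation negS v := [set s in powerset b | inner s v < 0]%SET.
Local Notation tieS v := [set s in powerset b | inner s v == 0]%SET.

Definition agreement (v z : {set T}) : {set T} :=
  [set j in b | (j \in z) == (j \in v)]%SET.

Lemma agreement_sub v z : agreement v z \subset b.
Proof. by apply/fintype.subsetP => j; rewrite inE => /andP[]. Qed.

Lemma agreementK (v z : {set T}) : z \subset b -> agreement v (agreement v z) = z.
Proof.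
move=> /fintype.subsetP zb; apply/setP => j; rewrite !inE.
have [jb|jb] /= := boolP (j \in b); first by case: (j \in z) (j \in v) => [] [].
by apply/esym; apply: contraNF jb; exact: zb.
Qed.

Lemma inner_agreement (z v : {set T}) :
  inner z v = out_range B0 b a * B0 * (2 * #|agreement v z|%:R - #|b|%:R).
Proof.
have -> : #|agreement v z| = (\sum_(j in b) ((j \in z) == (j \in v)))%N.
  rewrite -sum1_card [LHS]big_mkcond [RHS]big_mkcond /=.
  by apply: eq_bigr => j _; rewrite inE; case: (j \in b); case: (_ == _).
rewrite -[#|b|]sum1_card !natr_sum mulr_sumr -sumrB mulr_sumr.
apply: eq_bigr => j _; rewrite /pm_val.
by case: (j \in z) (j \in v) => [] [] /=; ring.
Qed.

Lemma inner_compl (z v : {set T}) : inner (b :\: z) v = - inner z v.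
Proof.
rewrite -sumrN; apply: eq_bigr => j jb.
by rewrite /pm_val inE jb andbT; case: (j \in z); rewrite /= ?mulNr ?opprK.
Qed.

(** Flipping all the coordinates of the output is a sign-reversing
    involution. *)
Lemma card_neg_pos v : #|negS v| = #|posS v|.
Proof.
rewrite -!sum1_card.
rewrite (reindex_onto (fun s => b :\: s)%SET (fun s => b :\: s)%SET) /=.
  apply: eq_bigl => s; rewrite !inE subsetDl inner_compl oppr_lt0 /=.
  rewrite finset.setDDr finset.setDv finset.set0U andbC; congr (_ && _).
  by apply/eqP/finset.setIidPr.
move=> s; rewrite !inE => /andP[sb _].
by rewrite finset.setDDr finset.setDv finset.set0U; apply/finset.setIidPr.
Qed.

(** A tie means that [z] and [v] agree on exactly half of the block, and the
    agreement set determines [z]. *)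
Lemma card_tie v :
  #|tieS v| = if odd #|b| then 0%N else 'C(#|b|, #|b|./2).
Proof.
have c_gt0 : 0 < out_range B0 b a * B0 by rewrite mulr_gt0 ?out_range_gt0.
have tieE z : (inner z v == 0) = (#|agreement v z|.*2 == #|b|).
  by rewrite inner_agreement mulrI_eq0 ?subr_eq0 -?natrM ?eqr_nat ?mul2n//;
     exact/lregP/lt0r_neq0.
case: ifPn => [kodd|keven].
  apply/eqP; rewrite cards_eq0 -finset.subset0; apply/fintype.subsetP => z.
  rewrite !inE tieE => /andP[_ /eqP k2].
  by move: kodd; rewrite -k2 odd_double.
rewrite -cards_draws -[LHS]sum1_card -[RHS]sum1_card.
rewrite (reindex_onto (agreement v) (agreement v)) /=; last first.
  by move=> z; rewrite !inE => /andP[zb _]; exact: agreementK.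
apply: eq_bigl => u; rewrite !inE tieE agreement_sub /=.
have half_eq m : (m.*2 == #|b|) = (m == #|b|./2).
  by rewrite -{1}(even_halfK keven) (inj_eq double_inj).
apply/andP/andP => [[h /eqP uE]|[ub h]].
  have ub : u \subset b by rewrite -uE agreement_sub.
  by move: h; rewrite agreementK// half_eq.
by rewrite agreementK// half_eq.
Qed.

Lemma card_sign v : (#|tieS v| + #|posS v|.*2 = 2 ^ #|b|)%N.
Proof.
rewrite -card_powerset -addnn -{2}card_neg_pos -!sum1_card.
rewrite ![\sum_(i in [set _ in _ | _]%SET) _]big_mkcond [RHS]big_mkcond.
rewrite -!big_split /=.
apply: eq_bigr => z _; rewrite !inE; case: (z \subset b) => //=.
by case: ltrgtP.
Qed.

(** The bias of [Y] is tuned so that, sign by sign, its weight compensates the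
    number of outputs with that sign. *)
Lemma nontie_paramE v : nontie_param R b = 2 * #|posS v|%:R / 2 ^+ #|b|.
Proof.
have k_neq0 : 2 ^+ #|b| != 0 :> R by rewrite expf_neq0.
have /(congr1 (fun m => m%:R : R)) := card_sign v.
rewrite natrD -mul2n natrM natrX card_tie => /(canRL (addKr _)) ->.
rewrite addrC mulrBl divff// /nontie_param.
by case: ifP => _ //; rewrite mul0r subr0.
Qed.

Lemma release_pmfE v z : v \in powerset b -> z \in powerset b ->
  release_pmf B0 b a v z =
    (2 ^+ #|b|)^-1 * (if 0 < inner z v then 2 * expR a / (1 + expR a)
                      else if inner z v < 0 then 2 / (1 + expR a) else 1).
Proof.
move=> vb zb; have e_gt0 := expR_gt0 a.
have k_neq0 : 2 ^+ #|b| != 0 :> R by rewrite expf_neq0.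
have e1_neq0 : 1 + expR a != 0 by rewrite lt0r_neq0// addr_gt0.
have N_neq0 : #|posS v|%:R != 0 :> R.
  rewrite pnatr_eq0 cards_eq0; apply/set0Pn; exists v.
  by rewrite inE vb inner_self.
have tiep : 1 - nontie_param R b = #|tieS v|%:R / 2 ^+ #|b|.
  rewrite (nontie_paramE v) -{1}(divff k_neq0) -natrX -(card_sign v).
  by rewrite natrD -mul2n natrM; ring.
rewrite /release_pmf !big_bool /= tiep (nontie_paramE v) /unif_pmf.
rewrite card_neg_pos !inE -!powersetE zb /=.
case: ltrgtP => inner0; rewrite ?mulr0n ?mulr1n ?mul0r ?mulr0 ?addr0 ?add0r.
- by field; rewrite k_neq0 e1_neq0 N_neq0.
- by field; rewrite k_neq0 e1_neq0 N_neq0.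
have tie_neq0 : #|tieS v|%:R != 0 :> R.
  rewrite pnatr_eq0 cards_eq0; apply/set0Pn; exists z.
  by rewrite inE zb inner0 eqxx.
by field; rewrite k_neq0 tie_neq0.
Qed.

(** Since [e^a >= 1], the density [1] of a tie lies between the two others,
    whose ratio is [e^a]. *)
Lemma release_pmf_ratio v v' z :
  v \in powerset b -> v' \in powerset b -> z \in powerset b ->
  release_pmf B0 b a v z <= expR a * release_pmf B0 b a v' z.
Proof.
move=> vb v'b zb; rewrite !release_pmfE// mulrCA.
rewrite ler_pM2l ?invr_gt0 ?exprn_gt0//.
have : 1 < expR a by rewrite pexpR_gt1.
set e := expR a => e_gt1.
have density_itv (s : R) :
    2 / (1 + e) <= (if 0 < s then 2 * e / (1 + e)
                    else if s < 0 then 2 / (1 + e) else 1) <= 2 * e / (1 + e).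
  case: ltrgtP => _; rewrite ?lexx ?andbT /=.
  - by rewrite ler_pM2r ?invr_gt0; lra.
  - by rewrite ler_pM2r ?invr_gt0; lra.
  - by rewrite ler_pdivrMr ?ler_pdivlMr; lra.
have /andP[_ up] := density_itv (inner z v).
have /andP[low _] := density_itv (inner z v').
apply: (le_trans up); rewrite [leLHS](_ : _ = e * (2 / (1 + e))); last by ring.
by rewrite ler_wpM2l// (le_trans ler01) ?ltW.
Qed.

Lemma block_pmf_ratio (phi phi' : T -> R) z :
  (forall j, `|phi j| <= B0) -> (forall j, `|phi' j| <= B0) ->
  z \in powerset b ->
  block_pmf B0 b a phi z <= expR a * block_pmf B0 b a phi' z.
Proof.
move=> phiB phi'B zb; apply: le_mean_ratio.
- by move=> v _; exact: tilde_pmf_ge0.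
- by move=> v _; exact: tilde_pmf_ge0.
- exact: sum_tilde_pmf.
- exact: sum_tilde_pmf.
- by move=> v v' vb v'b; exact: release_pmf_ratio.
Qed.

End block_privacy.

(** * All blocks *)

Lemma mechanism_pmf_ratio (R : realType) (d : nat) (D : block_design R d)
    (x x' : cube R d) (z : {set index_set D}) :
  mechanism_pmf x z <=
    expR (\sum_(b in blocks D) level D b) * mechanism_pmf x' z.
Proof.
rewrite expR_sum -big_split /=; apply: ler_prod => b bD.
have B0_gt0 := max_sup_norm_gt0 bD.
have a_gt0 := level_gt0 D b bD.
have b_neq0 := block_neq0 bD.
apply/andP; split.
  by apply: block_pmf_ge0 => // j; exact: fourier_le_max.
apply: block_pmf_ratio => //; try by move=> j; exact: fourier_le_max.
by rewrite powersetE subsetIr.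
Qed.

Theorem proposition2p1 (R : realType) (d n : nat) (hd : (0 < d)%N)
  (alpha : R) (halpha : 0 < alpha)
  (D : block_design R d)
  (hsum : \sum_(b in blocks D) level D b = alpha)
  (Q : R.-pker (n.-tuple (cube R d)) ~> (n.-tuple (rspace R (index_set D))))
  (hQ : generated_independently Q
          (fun _ : 'I_n => coordinate_block_mechanism D)) :
  noninteractive_LDP alpha Q.
Proof.
exists (fun _ => coordinate_block_mechanism D); split => // _.
by apply: mixture_private => x x' z; rewrite -hsum; exact: mechanism_pmf_ratio.
Qed.
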